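(* Consider an instance of the Steiner Team Orienteering Problem and the formulation $\mathcal{F}_2$ as described in the context, and let $\mathcal{K}$ be the set of conflicting vertex pairs. For every feasible solution $(x,y,f,\varphi)$ of $\mathcal{F}_2$, every pair $\langle i,j\rangle\in\mathcal{K}$ and every $V\subseteq N\setminus\{t\}$ with $\{i,j\}\subseteq V$, we have $\sum_{e\in\delta^+(V)}x_e\ge y_i+y_j$.
   Context: An instance of the Steiner Team Orienteering Problem (STOP) consists of: a digraph $G=(N,A)$; an origin $s\in N$ and a destination $t\in N$ with $s\neq t$; disjoint sets $S,P\subseteq N\setminus\{s,t\}$ (mandatory and profitable vertices) with $N=S\cup P\cup\{s,t\}$; rewards $p_i\in\mathbb{Z}^+$ for $i\in P$; traverse times $d_{ij}\in\mathbb{R}^+$ for $(i,j)\in A$; a number $m$ of vehicles and a time limit $T$. For $i\in N$ let $\delta^+(i)=\{j\in N:(i,j)\in A\}$ and $\delta^-(i)=\{j\in N:(j,i)\in A\}$; for $V\subseteq N$ let $\delta^+(V)=\{(i,j)\in A: i\in V, j\in N\setminus V\}$ and $\delta^-(V)=\{(i,j)\in A: i\in N\setminus V, j\in V\}$. For $i,j\in N$, $R_{ij}$ denotes the minimum of $\sum_{a\in A_p}d_a$ over all paths $p$ from $i$ to $j$ in $G$ (with arc set $A_p$), and $R_{ii}=0$. $\mathcal{K}$ is the set of pairs $\langle i,j\rangle$ with $i,j\in N\setminus\{s,t\}$ such that every route from $s$ to $t$ in $G$ visiting both $i$ and $j$ (in any order) has total traverse time (sum of $d$ over its arcs) exceeding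 $T$. $\mathcal{F}_2$: maximize $\sum_{i\in P}p_iy_i$ over $x\in\{0,1\}^A$, $y\in\{0,1\}^N$, $f\in\mathbb{R}^A$, $\varphi\in\mathbb{R}$ subject to: $y_i=1$ for all $i\in S\cup\{s,t\}$; $\sum_{j\in\delta^+(i)}x_{ij}=y_i$ for all $i\in S\cup P$; $\sum_{j\in\delta^+(s)}x_{sj}=\sum_{i\in\delta^-(t)}x_{it}=m-\varphi$; $\sum_{i\in\delta^-(s)}x_{is}=\sum_{j\in\delta^+(t)}x_{tj}=0$; $\sum_{j\in\delta^+(i)}x_{ij}-\sum_{j\in\delta^-(i)}x_{ji}=0$ for all $i\in S\cup P$; $f_{sj}=(T-d_{sj})x_{sj}$ for all $j\in\delta^+(s)$; $\sum_{j\in\delta^-(i)}f_{ji}-\sum_{j\in\delta^+(i)}f_{ij}=\sum_{j\in\delta^+(i)}d_{ij}x_{ij}$ for all $i\in S\cup P$; $f_{ij}\le(T-R_{si}-d_{ij})x_{ij}$ for all $(i,j)\in A$ with $i\neq s$; $f_{ij}\ge R_{jt}x_{ij}$ for all $(i,j)\in A$; $f\ge0$; $0\le\varphi\le m$. *)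

(* Defs.v *)
From HB Require Import structures.
From mathcomp Require Import all_boot all_order all_algebra.
From mathcomp Require Import classical_sets reals constructive_ereal ereal.
Set Implicit Arguments. Unset Strict Implicit. Unset Printing Implicit Defensive.
Import Order.TTheory GRing.Theory Num.Theory.
Local Open Scope ring_scope.

Record STOP (R : realType) := {
  N : finType;
  arcA : rel N;
  orig : N;
  dest : N;
  Sm : {set N};                   (* mandatory vertices S *)
  Pr : {set N};                   (* profitable vertices P *)
  rew : N -> nat;
  tt_ : N -> N -> R;              (* traverse times d_ij *)
  nveh : nat;
  Tlim : R;
  orig_neq_dest : orig != dest;
  SP_disjoint : [disjoint Sm & Pr];
  orig_notin : orig \notin Sm :|: Pr;
  dest_notin : dest \notin Sm :|: Pr;
  N_cover : [set: N] = Sm :|: Pr :|: [set orig; dest];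
  rew_pos : forall i, i \in Pr -> (0 < rew i)%N;
  tt_pos : forall i j, arcA i j -> 0 < tt_ i j
}.

Section Defs.
Variables (R : realType) (I : STOP R).
Local Notation N := (N I).
Local Notation A := (@arcA R I).
Local Notation d := (@tt_ R I).

Definition walk_time (u : N) (w : seq N) : R :=
  \sum_(e <- zip (u :: w) w) d e.1 e.2.

Definition is_walk (u v : N) (w : seq N) : Prop :=
  path A u w /\ last u w = v.

(* R_ij : minimum traverse time of a path from i to j (+oo if none);
   the trivial walk gives R_ii = 0. *)
Definition Rdist (i j : N) : \bar R :=
  ereal_inf [set (walk_time i w)%:E | w in [set w | is_walk i j w]].

Definition conflicting (i j : N) : Prop :=
  i \notin [set orig I; dest I] /\ j \notin [set orig I; dest I] /\
  forall w : seq N, is_walk (orig I) (dest I) w ->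
    i \in orig I :: w -> j \in orig I :: w -> Tlim I < walk_time (orig I) w.

Local Open Scope ereal_scope.

Definition F2_feasible (x : N -> N -> R) (y : N -> R) (f : N -> N -> R)
    (phi : R) : Prop :=
  let s := orig I in let t := dest I in let T := Tlim I in
  let m := (nveh I)%:R in
  let SP := Sm I :|: Pr I in
  (forall i j, A i j -> x i j = 0%R \/ x i j = 1%R) /\
      (forall i, y i = 0%R \/ y i = 1%R) /\
      (forall i, i \in Sm I :|: [set s; t] -> y i = 1%R) /\
      (forall i, i \in SP -> (\sum_(j | A i j) x i j)%R = y i) /\
      (\sum_(j | A s j) x s j)%R = (m - phi)%R /\ (\sum_(i | A i t) x i t)%R = (m - phi)%R /\
      (\sum_(i | A i s) x i s)%R = 0%R /\ (\sum_(j | A t j) x t j)%R = 0%R /\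
      (forall i, i \in SP -> (\sum_(j | A i j) x i j - \sum_(j | A j i) x j i)%R = 0%R) /\
      (forall j, A s j -> f s j = ((T - d s j) * x s j)%R) /\
      (forall i, i \in SP ->
         (\sum_(j | A j i) f j i - \sum_(j | A i j) f i j)%R
           = (\sum_(j | A i j) d i j * x i j)%R) /\
      (forall i j, A i j -> i != s ->
         (f i j)%:E <= (T%:E - Rdist s i - (d i j)%:E) * (x i j)%:E) /\
      (forall i j, A i j -> Rdist j t * (x i j)%:E <= (f i j)%:E) /\
      (forall i j, A i j -> (0 <= f i j)%R) /\
      (0 <= phi <= m)%R.

End Defs.

(* Main.v *)
Require Import Defs.
From HB Require Import structures.
From mathcomp Require Import all_boot all_order all_algebra.
From mathcomp Require Import classical_sets reals constructive_ereal ereal.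
Import Order.TTheory GRing.Theory Num.Theory.
Set Implicit Arguments. Unset Strict Implicit. Unset Printing Implicit Defensive.
Local Open Scope ring_scope.

(* The arcs with x = 1 form vehicle routes: at every vertex other than s and t
   at most one of them enters and at most one leaves, none enters s and none
   leaves t.  Flow conservation for f makes the inflow strictly decrease along
   these arcs, so from an active vertex one can walk back to s and forward to
   t, and the remaining time f bounds the time of the rest of the route, so
   every s-t route has length at most T.  A walk from an active vertex of V to
   t leaves V through some arc; if the walks from i and from j left through
   arcs with the same tail, then, predecessors being unique, i and j would lie
   on a common s-t route of length at most T, which a conflicting pair
   forbids.  Hence i and j contribute distinct unit terms to the cut. *)

Lemma lt_fin_ind (T : finType) (d : Order.disp_t) (U : porderType d)
    (g : T -> U) (Q : T -> Prop) :
  (forall v, (forall u, (g u < g v)%O -> Q u) -> Q v) -> forall v, Q v.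
Proof.
move=> IH v; move: {-1}#|_| (leqnn #|[set u | (g u < g v)%O]|) => n.
elim: n v => [|n IHn] v Hn; apply: IH => u ltuv.
  by move: Hn; rewrite leqn0 cards_eq0 => /eqP/setP/(_ u); rewrite !inE ltuv.
apply: IHn; rewrite -ltnS; apply: leq_trans Hn; apply: proper_card.
apply/properP; split; last by exists u; rewrite !inE ?ltxx.
by apply/fintype.subsetP => w; rewrite !inE => /lt_trans; apply.
Qed.

Section SumBounds.
Variables (T : finType) (R : numDomainType) (P : pred T) (F : T -> R).
Hypothesis F_ge0 : forall i, P i -> 0 <= F i.

Lemma ler_sum1 a : P a -> F a <= \sum_(i | P i) F i.
Proof.
move=> Pa; rewrite (bigD1 a) //= lerDl sumr_ge0 // => i /andP[Pi _].
exact: F_ge0.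
Qed.

Lemma ler_sum2 a b : a != b -> P a -> P b -> F a + F b <= \sum_(i | P i) F i.
Proof.
move=> ab Pa Pb; rewrite (bigD1 a) //= lerD2l (bigD1 b) /= ?Pb 1?eq_sym //.
by rewrite lerDl sumr_ge0 // => i /andP[/andP[Pi _] _]; apply: F_ge0.
Qed.

Lemma sum01_uniq a b : \sum_(i | P i) F i <= 1 ->
  P a -> P b -> F a = 1 -> F b = 1 -> a = b.
Proof.
move=> le1 Pa Pb Fa Fb; apply/eqP/negPn/negP => /ler_sum2/(_ Pa Pb).
by rewrite Fa Fb => /le_trans/(_ le1); rewrite gerDl ler10.
Qed.

Lemma sum01_witness : (forall i, P i -> F i = 0 \/ F i = 1) ->
  \sum_(i | P i) F i != 0 -> exists2 i, P i & F i = 1.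
Proof.
move=> F01; have [i /andP[Pi /eqP Fi] _|no] := pickP (fun i => P i && (F i == 1)).
  by exists i.
rewrite big1 ?eqxx // => i Pi; have := no i; rewrite Pi /=.
by case: (F01 i Pi) => ->; rewrite ?eqxx.
Qed.

End SumBounds.

Section Connect.
Variables (T : finType) (e : rel T).

Lemma connect_exit (V : {set T}) a z : connect e a z -> a \in V -> z \notin V ->
  exists b c, [/\ connect e a b, b \in V, c \notin V & e b c].
Proof.
case/connectP => p + ->; elim: p a => [|c p IHp] a /=; first by move=> _ ->.
case/andP=> eac pc aV; case: (boolP (c \in V)) => [cV /(IHp c pc cV)|cV _].
  case=> b [c' [cb bV c'V ebc']]; exists b, c'; split=> //.
  exact: connect_trans (connect1 eac) cb.
by exists a, c; split.
Qed.

Lemma connect3_path s u v t : connect e s u -> connect e u v -> connect e v t ->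
  exists2 w, path e s w /\ last s w = t & (u \in s :: w) && (v \in s :: w).
Proof.
move=> /connectP[p1 pp1 ->] /connectP[p2 pp2 ->] /connectP[p3 pp3 ->].
exists (p1 ++ p2 ++ p3); first by rewrite !cat_path !last_cat pp1 pp2 pp3.
rewrite catA; apply/andP; split; rewrite -cat_cons mem_cat; apply/orP; left.
  by rewrite -cat_cons mem_cat mem_last.
by rewrite -last_cat mem_last.
Qed.

Variable t : T.
Hypothesis sink_t : forall v, ~~ e t v.
Hypothesis pred_uniq : forall v c c', v != t -> e c v -> e c' v -> c = c'.

Lemma connect_to_common u v a : a != t -> connect e u a -> connect e v a ->
  connect e u v \/ connect e v u.
Proof.
move=> + /connectP[p]; elim/last_ind: p a v => [|p b IHp] a v at_ /=.
  by move=> _ -> va; right.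
rewrite rcons_path last_rcons => /andP[pu ecb] ab; subst a => /connectP[q].
case/lastP: q => [_ /= vb|q b']; last rewrite rcons_path last_rcons.
  by left; apply/connectP; exists (rcons p b); rewrite ?rcons_path ?pu ?last_rcons.
move=> /andP[qv ecb'] bb'; subst b'.
have ct : last u p != t by apply: contraNneq (sink_t b) => <-.
apply: (IHp (last u p)) => //; apply/connectP; exists q => //.
exact: pred_uniq at_ ecb ecb'.
Qed.

End Connect.

Section Instance.
Variables (R : realType) (I : STOP R).

Local Notation s := (orig I).
Local Notation t := (dest I).
Local Notation SP := (Sm I :|: Pr I).

Lemma in_SP v : (v \in SP) = (v != s) && (v != t).
Proof.
have : v \in [set: N I] by rewrite inE.
rewrite -negb_or -in_set2 (N_cover I) inE.
case: (boolP (v \in [set s; t])) => [|_ /orP[] //].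
by case/set2P=> -> _; apply/negbTE; [exact: orig_notin | exact: dest_notin].
Qed.

Lemma walk_time_cons (u v : N I) w :
  walk_time (I := I) u (v :: w) = tt_ u v + walk_time v w.
Proof. by rewrite /walk_time /= big_cons. Qed.

Lemma conflicting_sym (i j : N I) : conflicting i j -> conflicting j i.
Proof. by case=> iST [jST Hw]; do 2!split=> //; move=> w /Hw Hw' ji ij; apply: Hw'. Qed.

Section Feasible.
Variables (x : N I -> N I -> R) (y : N I -> R) (f : N I -> N I -> R) (phi : R).
Hypothesis feas : F2_feasible x y f phi.

Local Notation A := (@arcA R I).
Local Notation d := (@tt_ R I).

Lemma x01 u v : A u v -> x u v = 0 \/ x u v = 1.
Proof. by case: feas => + _; apply. Qed.

Lemma y01 v : y v = 0 \/ y v = 1.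
Proof. by case: feas => _ [+ _]. Qed.

Lemma out_x v : v \in SP -> \sum_(w | A v w) x v w = y v.
Proof. by case: feas => _ [_ [_ [+ _]]]; apply. Qed.

Lemma in_x v : v \in SP -> \sum_(w | A w v) x w v = y v.
Proof.
move=> vSP; rewrite -out_x //; apply/eqP; rewrite eq_sym -subr_eq0; apply/eqP.
by case: feas => _ [_ [_ [_ [_ [_ [_ [_ [+ _]]]]]]]]; apply.
Qed.

Lemma in_x_s : \sum_(w | A w s) x w s = 0.
Proof. by case: feas => _ [_ [_ [_ [_ [_ [+ _]]]]]]. Qed.

Lemma out_x_t : \sum_(w | A t w) x t w = 0.
Proof. by case: feas => _ [_ [_ [_ [_ [_ [_ [+ _]]]]]]]. Qed.

Lemma f_s v : A s v -> f s v = (Tlim I - d s v) * x s v.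
Proof. by case: feas => _ [_ [_ [_ [_ [_ [_ [_ [_ [+ _]]]]]]]]]; apply. Qed.

Lemma in_out_f v : v \in SP ->
  \sum_(w | A w v) f w v - \sum_(w | A v w) f v w = \sum_(w | A v w) d v w * x v w.
Proof. by case: feas => _ [_ [_ [_ [_ [_ [_ [_ [_ [_ [+ _]]]]]]]]]]; apply. Qed.

Lemma f_le u v : A u v -> u != s ->
  ((f u v)%:E <= ((Tlim I)%:E - Rdist s u - (d u v)%:E) * (x u v)%:E)%E.
Proof. by case: feas => _ [_ [_ [_ [_ [_ [_ [_ [_ [_ [_ [+ _]]]]]]]]]]]; apply. Qed.

Lemma f_ge0 u v : A u v -> 0 <= f u v.
Proof. by case: feas => _ [_ [_ [_ [_ [_ [_ [_ [_ [_ [_ [_ [_ [+ _]]]]]]]]]]]]]; apply. Qed.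

Lemma x_ge0 u v : A u v -> 0 <= x u v.
Proof. by case/x01=> ->. Qed.

Lemma y_le1 v : y v <= 1.
Proof. by case: (y01 v) => ->; rewrite ?ler01. Qed.

Lemma y_ge1 v : 1 <= y v -> y v = 1.
Proof. by case: (y01 v) => ->; rewrite ?ler10. Qed.

Lemma f_eq0 u v : A u v -> x u v = 0 -> f u v = 0.
Proof.
case: (eqVneq u s) => [->|us] Auv xuv; first by rewrite f_s // xuv mulr0.
apply/eqP; rewrite eq_le f_ge0 // andbT.
by have := f_le Auv us; rewrite xuv mule0 lee_fin.
Qed.

Definition sel u v := A u v && (x u v == 1).

Lemma selA u v : sel u v -> A u v.
Proof. by case/andP. Qed.

Lemma x_eq0 u v : A u v -> ~~ sel u v -> x u v = 0.
Proof. by move=> Auv; rewrite /sel Auv /=; case: (x01 Auv) => ->; rewrite ?eqxx. Qed.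

Lemma no_sel_into_s c : ~~ sel c s.
Proof.
apply/negP=> /andP[Acs /eqP xcs].
by have := ler_sum1 (fun w => @x_ge0 w s) Acs; rewrite in_x_s xcs ler10.
Qed.

Lemma no_sel_from_t v : ~~ sel t v.
Proof.
apply/negP=> /andP[Atv /eqP xtv].
by have := ler_sum1 (fun w => @x_ge0 t w) Atv; rewrite out_x_t xtv ler10.
Qed.

Lemma sel_succ_uniq v u u' : v \in SP -> sel v u -> sel v u' -> u = u'.
Proof.
move=> vSP /andP[Au /eqP xu] /andP[Au' /eqP xu'].
by apply: (sum01_uniq (fun w => @x_ge0 v w) _ Au Au' xu xu'); rewrite out_x ?y_le1.
Qed.

Lemma sel_pred_uniq v c c' : v != t -> sel c v -> sel c' v -> c = c'.
Proof.
move=> vt; have [->|vs] := eqVneq v s; first by rewrite (negbTE (no_sel_into_s c)).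
have vSP : v \in SP by rewrite in_SP vs vt.
move=> /andP[Ac /eqP xc] /andP[Ac' /eqP xc'].
by apply: (sum01_uniq (fun w => @x_ge0 w v) _ Ac Ac' xc xc'); rewrite in_x ?y_le1.
Qed.

Lemma active_out v : v \in SP -> y v = 1 <-> exists u, sel v u.
Proof.
move=> vSP; split=> [yv|[u /andP[Au /eqP xu]]].
  have [|u Au xu] := sum01_witness (fun w => @x01 v w); first by rewrite out_x ?yv ?oner_eq0.
  by exists u; rewrite /sel Au xu eqxx.
by apply: y_ge1; rewrite -out_x // -xu (ler_sum1 (fun w => @x_ge0 v w)).
Qed.

Lemma active_in v : v \in SP -> y v = 1 <-> exists c, sel c v.
Proof.
move=> vSP; split=> [yv|[c /andP[Ac /eqP xc]]].
  have [|c Ac xc] := sum01_witness (fun w => @x01 w v); first by rewrite in_x ?yv ?oner_eq0.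
  by exists c; rewrite /sel Ac xc eqxx.
by apply: y_ge1; rewrite -in_x // -xc (ler_sum1 (fun w => @x_ge0 w v)).
Qed.

Lemma x_succ_eq0 v u w : v \in SP -> sel v u -> A v w -> w != u -> x v w = 0.
Proof.
move=> vSP svu Avw wu; apply: (x_eq0 Avw); apply: contra wu => svw.
by rewrite (sel_succ_uniq vSP svw svu).
Qed.

Definition inflow v := \sum_(w | A w v) f w v.

Lemma inflow_sel p v : v \in SP -> sel p v -> inflow v = f p v.
Proof.
move=> vSP spv; rewrite /inflow (bigD1 p) ?selA //= big1 ?addr0 // => c /andP[Ac cp].
apply: f_eq0 Ac (x_eq0 Ac _); apply: contra cp => scv.
by rewrite (sel_pred_uniq _ scv spv) //; move: vSP; rewrite in_SP => /andP[].
Qed.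

Lemma inflow_sel_out v u : v \in SP -> sel v u -> inflow v = f v u + d v u.
Proof.
move=> vSP svu.
have out_f : \sum_(w | A v w) f v w = f v u.
  rewrite (bigD1 u) ?selA //= big1 ?addr0 // => w /andP[Avw wu].
  exact: f_eq0 Avw (x_succ_eq0 vSP svu Avw wu).
have delay : \sum_(w | A v w) d v w * x v w = d v u.
  rewrite (bigD1 u) ?selA //= big1 ?addr0 => [|w /andP[Avw wu]].
    by case/andP: svu => _ /eqP ->; rewrite mulr1.
  by rewrite (x_succ_eq0 vSP svu Avw wu) mulr0.
by have := in_out_f vSP; rewrite out_f delay -/(inflow v) => <-; rewrite addrC subrK.
Qed.

Lemma inflow_lt p v : p \in SP -> v \in SP -> sel p v -> inflow v < inflow p.
Proof.
move=> pSP vSP spv; rewrite (inflow_sel vSP spv) (inflow_sel_out pSP spv) ltrDl.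
exact: tt_pos (selA spv).
Qed.

Lemma active_reach_t v : v \in SP -> y v = 1 -> connect sel v t.
Proof.
elim/(lt_fin_ind (g := inflow)): v => v IH vSP /(active_out vSP)[u svu].
have us : u != s by apply: contraNneq (no_sel_into_s v) => <-.
have [<-|ut] := eqVneq u t; first exact: connect1.
have uSP : u \in SP by rewrite in_SP us ut.
apply: connect_trans (connect1 svu) (IH u (inflow_lt vSP uSP svu) uSP _).
by apply/(active_in uSP); exists v.
Qed.

Lemma s_reach_active v : v \in SP -> y v = 1 -> connect sel s v.
Proof.
elim/(lt_fin_ind (g := fun v => - inflow v)): v => v IH vSP /(active_in vSP)[p spv].
have pt : p != t by apply: contraNneq (no_sel_from_t v) => <-.
have [<-|ps] := eqVneq p s; first exact: connect1.
have pSP : p \in SP by rewrite in_SP ps pt.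
have lt_vp : - inflow p < - inflow v by rewrite ltrN2 (inflow_lt pSP vSP spv).
apply: connect_trans (IH p lt_vp pSP _) (connect1 spv).
by apply/(active_out pSP); exists v.
Qed.

Lemma walk_time_le_flow w p v :
  sel p v -> path sel v w -> last v w = t -> walk_time v w <= f p v.
Proof.
elim: w p v => [|u w IHw] p v spv /=.
  by move=> _ _; rewrite /walk_time big_nil f_ge0 ?selA.
case/andP=> svu pw lw.
have vs : v != s by apply: contraNneq (no_sel_into_s p) => <-.
have vt : v != t by apply: contraNneq (no_sel_from_t u) => <-.
have vSP : v \in SP by rewrite in_SP vs vt.
rewrite walk_time_cons -(inflow_sel vSP spv) (inflow_sel_out vSP svu) addrC lerD2r.
exact: IHw svu pw lw.
Qed.

Lemma route_time_le w : path sel s w -> last s w = t -> walk_time s w <= Tlim I.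
Proof.
case: w => [|v w] /=; first by move=> _ st; have := orig_neq_dest I; rewrite st eqxx.
case/andP=> ssv pw lw; rewrite walk_time_cons -lerBrDl.
have := walk_time_le_flow ssv pw lw; rewrite f_s ?selA //.
by case/andP: ssv => _ /eqP ->; rewrite mulr1.
Qed.

Lemma conflicting_off_routes i j : conflicting i j ->
  connect sel s i -> connect sel i j -> connect sel j t -> False.
Proof.
case=> _ [_ Hw] si ij jt; have [w [pw lw] /andP[iw jw]] := connect3_path si ij jt.
have walk : is_walk s t w by split=> //; apply: sub_path pw => u v /andP[].
by have := Hw w walk iw jw; rewrite ltNge route_time_le.
Qed.

Lemma conflicting_no_common_exit i j a : conflicting i j ->
    i \in SP -> y i = 1 -> j \in SP -> y j = 1 ->
  a != t -> connect sel i a -> connect sel j a -> False.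
Proof.
move=> ij iSP yi jSP yj at_ ia ja.
have [ij'|ji] := connect_to_common no_sel_from_t sel_pred_uniq at_ ia ja.
  exact: conflicting_off_routes ij (s_reach_active iSP yi) ij' (active_reach_t jSP yj).
apply: conflicting_off_routes (conflicting_sym ij) (s_reach_active jSP yj) ji _.
exact: active_reach_t iSP yi.
Qed.

Variable V : {set N I}.
Hypothesis tV : t \notin V.

Lemma active_exit v : v \in SP -> y v = 1 -> v \in V ->
  exists a b, [/\ connect sel v a, a \in V, b \notin V & sel a b].
Proof. by move=> vSP yv vV; apply: connect_exit (active_reach_t vSP yv) vV tV. Qed.

Lemma cut_out_ge0 u : 0 <= \sum_(w in ~: V | A u w) x u w.
Proof. by apply: sumr_ge0 => w /andP[_]; apply: x_ge0. Qed.

Lemma cut_out_ge1 a b : sel a b -> b \notin V -> 1 <= \sum_(w in ~: V | A a w) x a w.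
Proof.
case/andP=> Aab /eqP xab bV; rewrite -xab (ler_sum1 (P := fun w => (w \in ~: V) && A a w)) //.
  by move=> w /andP[_]; apply: x_ge0.
by rewrite inE bV Aab.
Qed.

Lemma active_cut_ge1 v : v \in SP -> y v = 1 -> v \in V ->
  1 <= \sum_(u in V) \sum_(w in ~: V | A u w) x u w.
Proof.
move=> vSP yv vV; have [a [b [_ aV bV sab]]] := active_exit vSP yv vV.
by apply: le_trans (cut_out_ge1 sab bV) (ler_sum1 (fun u _ => cut_out_ge0 u) aV).
Qed.

End Feasible.
End Instance.

Theorem corollary2 (R : realType) (I : STOP R)
    (x : N I -> N I -> R) (y : N I -> R) (f : N I -> N I -> R) (phi : R) :
  F2_feasible x y f phi ->
  forall i j : N I, conflicting i j ->
  forall V : {set N I}, dest I \notin V -> i \in V -> j \in V ->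
    y i + y j <= \sum_(u in V) \sum_(v in ~: V | arcA u v) x u v.
Proof.
move=> feas i j ij V tV iV jV.
have [iSP jSP] : (i \in Sm I :|: Pr I) /\ (j \in Sm I :|: Pr I).
  by case: ij => iST [jST _]; rewrite !in_SP -!negb_or -!in_set2.
case: (y01 feas i) => yi; case: (y01 feas j) => yj; rewrite yi yj.
- by rewrite addr0; apply: sumr_ge0 => u _; apply: (cut_out_ge0 feas).
- by rewrite add0r; apply: (active_cut_ge1 feas tV jSP yj jV).
- by rewrite addr0; apply: (active_cut_ge1 feas tV iSP yi iV).
have [a [b [ia aV bV sab]]] := active_exit feas tV iSP yi iV.
have [a' [b' [ja' a'V b'V sab']]] := active_exit feas tV jSP yj jV.
have aa' : a != a'.
  apply/eqP=> eqa; subst a'; have at_ : a != dest I by apply: contraNneq tV => <-.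
  exact (conflicting_no_common_exit feas ij iSP yi jSP yj at_ ia ja').
apply: le_trans (ler_sum2 (fun u _ => cut_out_ge0 feas V u) aa' aV a'V).
by apply: lerD; [apply: (cut_out_ge1 feas sab bV) | apply: (cut_out_ge1 feas sab' b'V)].
Qed.
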